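(* Let $G$ be a four-dimensional connected Lie group with Lie algebra $\mathfrak g$, let $\mathfrak p\subset\mathfrak g$ be a two-dimensional subspace generating $\mathfrak g$ by the Lie bracket, let $F$ be a seminorm on $\mathfrak p$ with $F(u)>0$ for $u\neq0$, and let $d$ be the left-invariant sub-Finsler quasimetric on $G$ defined by $(\mathfrak p,F)$. Let $(e_1,e_2,e_3,e_4)$ be a basis of $\mathfrak g$ such that $e_1,e_2\in\mathfrak p$, $[e_1,e_2]=e_3$, $[e_1,e_3]=e_4$ and $C_{23}^4=0$. Then an abnormal extremal $$g(t)=\exp\left(\frac{s\,t\,e_2}{F(se_2)}\right),\quad t\in\mathbb R,\quad s=\pm1,$$ of $(G,d)$ is non-strictly abnormal if and only if either $C_{23}^1=C_{23}^2=0$, or $C_{23}^1\neq0$ and $F_U(0,s)=1/F(0,s)$, $s=\pm1$.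
   Context: $C_{ij}^k$ are the structure constants in the basis: $[e_i,e_j]=\sum_k C_{ij}^k e_k$. A basis as in the claim always exists; moreover, if $[e_2,e_3]$ is not a linear combination of $e_2$ and $e_3$, then $e_1$ can be chosen so that $C_{23}^2=0$. A seminorm $F$ on $\mathfrak p$ is a function $F:\mathfrak p\to[0,\infty)$ with $F(u+v)\le F(u)+F(v)$ and $F(\lambda u)=\lambda F(u)$ for $\lambda\geq 0$ (symmetry $F(-u)=F(u)$ is not required); $U=\{u\in\mathfrak p: F(u)\le 1\}$. In coordinates, $u=u_1e_1+u_2e_2$ is written $(u_1,u_2)$, $F(u_1,u_2):=F(u)$, and $$F_U(x,y)=\max_{(u_1,u_2)\in U}(xu_1+yu_2)$$ is the supporting Minkowski function of $U$. The quasimetric $d(g,h)$ is the infimum of $\int F(u(t))\,dt$ over absolutely continuous curves from $g$ to $h$ with $\dot g(t)=dl_{g(t)}(u(t))$, $u(t)\in\mathfrak p$ measurable, where $l_g(h)=gh$. An extremal of $(G,d)$ is a parameterized curve $g:\Omega\to G$ with maximal admissible connected domain $\Omega\subset\mathbb R$ satisfying almost everywhere the Pontryagin maximum principle for the time-optimal problem $\dot g(t)=dl_{g(t)}(u(t))$, $u(t)\in U$, with $F(u(t))=1$ and with a measurable control $u$; identifying covectors with elements of $\mathfrak g^*$ by left translation, this means that there is a nowhere zero absolutely continuous $\psi:\Omega\to\mathfrak g^*$ such that for almost all $t$ $$\dot g(t)=dl_{g(t)}(u(t)),\quad \tfrac{d}{dt}\big(\psi(t)(v)\big)=\psi(t)([u(t),v])\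 \ (v\in\mathfrak g),\quad F(u(t))=1,$$ $$\psi(t)(u(t))=\max_{u\in U}\psi(t)(u)=M,$$ where $M\ge 0$ is a constant. The extremal is abnormal if this holds for some $\psi$ with $M=0$, and normal if it holds for some $\psi$ with $M>0$. An abnormal extremal is non-strictly abnormal if it is also normal, and strictly abnormal otherwise.
   Formalization: The formal theorem additionally assumes that C_23^2 = 0 whenever C_23^1 ≠ 0 (the choice of e_1 that is always possible); without this normalization of the basis the stated equivalence fails, e.g. on SO(3)×R with a Euclidean norm. *)

(* Defs.v *)
From HB Require Import structures.
From mathcomp Require Import all_boot all_order all_algebra.
From mathcomp Require Import all_classical all_reals all_analysis.
From mathcomp Require Import ring.
Set Implicit Arguments. Unset Strict Implicit. Unset Printing Implicit Defensive.
Import Order.TTheory GRing.Theory Num.Theory.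
Import numFieldNormedType.Exports.
Local Open Scope classical_set_scope.
Local Open Scope ring_scope.

Section Smooth.
Context {R : realType} {V W : normedModType R}.

(* Meaningful for D open only. *)
Fixpoint Ck (k : nat) (D : set V) (f : V -> W) : Prop :=
  if k is k'.+1 then
    (forall x, D x -> differentiable f x) /\ (forall v, Ck k' D ('D_v f))
  else forall x, D x -> {for x, continuous f}.

Definition smooth_on (D : set V) (f : V -> W) := forall k, Ck k D f.

Lemma near_eq_differentiable (f g : V -> W) (x : V) :
  {near x, f =1 g} -> differentiable f x -> differentiable g x.
Proof.
move=> fg df.
have fgx : f x = g x by exact: nbhs_singleton fg.
have E : g \o shift x = cst (g x) + 'd f x +o_ 0 id.
  apply/eqaddoP => _/posnumP[e].
  have := diff_locally df => /eqaddoP /(_ _ (gt0 e)) H.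
  have fg0 : \forall h \near (0 : V), f (h + x) = g (h + x).
    by move: fg; rewrite (near_shift 0) /=; apply: filterS => h /=; rewrite subr0.
  near=> h.
  have h1 : f (h + x) = g (h + x) by near: h.
  rewrite /= !fctE /= -h1 -fgx; near: h.
  by apply: filterS H => h; rewrite !fctE.
have dE := diff_unique (diff_continuous df) E.
apply/diff_locallyP; rewrite dE; split => //.
exact: diff_continuous.
Unshelve. all: by end_near. Qed.

Lemma Ck_ext k (D : set V) (f g : V -> W) : open D ->
  (forall x, D x -> f x = g x) -> Ck k D f -> Ck k D g.
Proof.
move=> oD; elim: k f g => [|k IH] f g fg /=.
  move=> Cf x Dx; have nx : {near x, f =1 g}.
    by apply: filterS (open_nbhs_nbhs (conj oD Dx)) => y /fg.
  rewrite /prop_for /continuous_at -(fg _ Dx).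
  apply: cvg_trans (Cf x Dx); apply: near_eq_cvg.
  by apply: filterS nx => y ->.
have nx x : D x -> {near x, f =1 g}.
  by move=> Dx; apply: filterS (open_nbhs_nbhs (conj oD Dx)) => y /fg.
move=> [df Cf]; split=> [x Dx|v].
  exact: near_eq_differentiable (nx x Dx) (df x Dx).
apply: IH (Cf v) => x Dx; case: (eqVneq v 0) => [->|v0].
  by rewrite !derive0.
exact: near_eq_derive (nx x Dx).
Qed.

Lemma CkS k (D : set V) (f : V -> W) : Ck k.+1 D f -> Ck k D f.
Proof.
elim: k f => [|k IH] f /= [df Cf].
  by move=> x /df; exact: differentiable_continuous.
by split=> // v; apply: IH; exact: Cf.
Qed.

Lemma Ck_lin k (D : set V) (a : R) (f g : V -> W) : open D ->
  Ck k D f -> Ck k D g -> Ck k D (a *: f + g).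
Proof.
move=> oD; elim: k f g => [|k IH] f g /=.
  move=> Cf Cg x Dx; apply: continuousD (Cg x Dx).
  by apply: continuousZl_tmp; exact: Cf.
move=> [df Cf] [dg Cg]; split=> [x Dx|v].
  by apply: differentiableD (dg x Dx); apply: differentiableZ; exact: df.
apply: Ck_ext (IH _ _ (Cf v) (Cg v)) => // x Dx.
have dfx := diff_derivable (v:=v) (df x Dx); have dgx := diff_derivable (v:=v) (dg x Dx).
by rewrite deriveD ?deriveZ //; exact: derivableZ.
Qed.

End Smooth.

Lemma Ck_mul {R : realType} {V : normedModType R} k (D : set V)
  (f g : V -> R) : open D -> Ck k D f -> Ck k D g -> Ck k D (f * g).
Proof.
move=> oD; elim: k f g => [|k IH] f g /=.
  by move=> Cf Cg x Dx; apply: continuousM; [exact: Cf|exact: Cg].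
move=> Cf Cg; have [df Df] := Cf; have [dg Dg] := Cg.
split=> [x Dx|v]; first by apply: differentiableM; [exact: df|exact: dg].
have H : Ck k D (1 *: (f * 'D_v g) + g * 'D_v f).
  by apply: Ck_lin => //; apply: IH => //; exact: CkS.
apply: Ck_ext H => // x Dx.
have dfx := diff_derivable (v:=v) (df x Dx); have dgx := diff_derivable (v:=v) (dg x Dx).
by rewrite deriveM //= !fctE scale1r.
Qed.

Record chart (R : realType) (n : nat) (M : Type) := Chart {
  cdom : set M;
  cmap : M -> 'rV[R]_n;
  cinv : 'rV[R]_n -> M
}.

Definition cimg (R : realType) (n : nat) (M : Type) (c : chart R n M) :
  set 'rV[R]_n := cmap c @` cdom c.

Definition is_chart (R : realType) (n : nat) (M : topologicalType)
    (c : chart R n M) : Prop :=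
  [/\ open (cdom c), open (cimg c),
      forall x, cdom c x -> cinv c (cmap c x) = x,
      forall x, cdom c x -> {for x, continuous (cmap c)} &
      forall y, cimg c y -> {for y, continuous (cinv c)}].

HB.mixin Record isLieGroup (R : realType) (n : nat) G
    of Topological G & Group G := {
  atlas : set (chart R n G);
  atlas_chart : forall c, atlas c -> is_chart c;
  atlas_cover : forall x : G, exists2 c, atlas c & cdom c x;
  atlas_compat : forall c c', atlas c -> atlas c' ->
    smooth_on (cmap c @` (cdom c `&` cdom c')) (cmap c' \o cinv c);
  lie_hausdorff : hausdorff_space G;
  lie_second_countable : @second_countable G;
  mul_continuous : continuous (fun z : G * G => (z.1 * z.2)%g);
  inv_continuous : continuous (fun x : G => (x^-1)%g);
  mul_smooth : forall c1 c2 c3, atlas c1 -> atlas c2 -> atlas c3 ->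
    smooth_on
      [set z : 'rV[R]_n * 'rV[R]_n | [/\ cimg c1 z.1, cimg c2 z.2 &
         cdom c3 (cinv c1 z.1 * cinv c2 z.2)%g]]
      (fun z => cmap c3 (cinv c1 z.1 * cinv c2 z.2)%g);
  inv_smooth : forall c1 c2, atlas c1 -> atlas c2 ->
    smooth_on [set z | cimg c1 z /\ cdom c2 (cinv c1 z)^-1%g]
      (fun z => cmap c2 (cinv c1 z)^-1%g)
}.

#[short(type="lieGroupType")]
HB.structure Definition LieGroup (R : realType) (n : nat) :=
  { G of Topological G & Group G & isLieGroup R n G }.

Section LieAlgebra.
Context {R : realType} {n : nat} (G : lieGroupType R n).
Implicit Types (f h : G -> R^o).

Definition Csmooth f : Prop :=
  forall c : chart R n G, atlas c -> smooth_on (cimg c) (f \o cinv c).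

Lemma Csmooth_lin (a : R) f h : Csmooth f -> Csmooth h -> Csmooth (a *: f + h).
Proof.
move=> sf sh c Ac k; have [_ oc _ _ _] := atlas_chart c Ac.
exact: Ck_lin (sf c Ac k) (sh c Ac k).
Qed.

Lemma Csmooth_mul f h : Csmooth f -> Csmooth h -> Csmooth (f * h).
Proof.
move=> sf sh c Ac k; have [_ oc _ _ _] := atlas_chart c Ac.
exact: Ck_mul (sf c Ac k) (sh c Ac k).
Qed.

(* A left-invariant vector field is a derivation of C^oo(G) commuting with left
   translations; to make extensional equality of operators on all functions
   coincide with equality of fields, it is extended by 0 off C^oo(G). *)
Definition is_left_invariant_field (X : (G -> R^o) -> (G -> R^o)) : Prop :=
  [/\ forall f, ~ Csmooth f -> X f = 0,
      forall f, Csmooth f -> Csmooth (X f),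
      forall a f h, Csmooth f -> Csmooth h -> X (a *: f + h) = a *: X f + X h,
      forall f h, Csmooth f -> Csmooth h -> X (f * h) = X f * h + f * X h &
      forall (a : G) f, Csmooth f ->
        X (fun x => f (a * x)%g) = fun x => X f (a * x)%g].

Definition left_invariant_field : {pred (G -> R^o) -> (G -> R^o)} :=
  fun X => `[< is_left_invariant_field X >].

Record lieAlg := LieAlg {
  lie_field :> (G -> R^o) -> (G -> R^o);
  lie_fieldP : lie_field \in left_invariant_field
}.

HB.instance Definition _ := [isSub for lie_field].
HB.instance Definition _ := [Choice of lieAlg by <:].

Lemma Csmooth0 : Csmooth 0.
Proof.
move=> c Ac k; have [_ oc _ _ _] := atlas_chart c Ac.
have C0 j : Ck j (cimg c) (cst 0 : 'rV[R]_n -> R^o).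
  elim: j => [|j IH] /=; first by move=> x _; exact: cst_continuous.
  split=> [x _|v]; first exact: differentiable_cst.
  by apply: Ck_ext IH => // x _; rewrite derive_cst.
exact: C0.
Qed.

Lemma left_invariant_field_submod : submod_closed left_invariant_field.
Proof.
split.
  apply/asboolP; split=> //.
  - by move=> f _; exact: Csmooth0.
  - by move=> a f h _ _; rewrite scaler0 addr0.
  - by move=> f h _ _; rewrite mul0r mulr0 addr0.
move=> a X Y /asboolP[X0 XC XL XM XI] /asboolP[Y0 YC YL YM YI].
have E f : (a *: X + Y) f = a *: X f + Y f by [].
apply/asboolP; split=> [f nf|f sf|b f h sf sh|f h sf sh|b f sf].
- by rewrite E X0 // Y0 // scaler0 addr0.
- by rewrite E; apply: Csmooth_lin; [exact: XC|exact: YC].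
- by rewrite !E XL // YL // !scalerDr !scalerA [b * a]mulrC addrACA.
- rewrite !E XM // YM //; apply/funext => x.
  have A (a1 a2 a3 a4 a5 a6 c1 : R) :
    c1 * (a1 * a2 + a3 * a4) + (a5 * a2 + a3 * a6) =
    (c1 * a1 + a5) * a2 + a3 * (c1 * a4 + a6) by ring.
  exact: A.
- by rewrite !E XI // YI.
Qed.

HB.instance Definition _ := GRing.isSubmodClosed.Build R
  ((G -> R^o) -> (G -> R^o)) left_invariant_field left_invariant_field_submod.
HB.instance Definition _ := [SubChoice_isSubLmodule of lieAlg by <:].

Lemma lie_bracket_subproof (X Y : lieAlg) :
  (fun f => X (Y f) - Y (X f)) \in left_invariant_field.
Proof.
case: X Y => [X /asboolP[X0 XC XL XM XI]] [Y /asboolP[Y0 YC YL YM YI]] /=.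
have XZ : X 0 = 0.
  by have := XL (-1) _ _ Csmooth0 Csmooth0; rewrite scaler0 addr0 scaleN1r addNr.
have YZ : Y 0 = 0.
  by have := YL (-1) _ _ Csmooth0 Csmooth0; rewrite scaler0 addr0 scaleN1r addNr.
apply/asboolP; split=> [f nf|f sf|b f h sf sh|f h sf sh|b f sf].
- by rewrite (X0 _ nf) (Y0 _ nf) XZ YZ subr0.
- rewrite addrC -scaleN1r; apply: Csmooth_lin; first by apply/YC/XC.
  by apply/XC/YC.
- rewrite XL // YL // XL ?YL //; try exact: XC; try exact: YC.
  by rewrite opprD scalerBr addrACA.
- rewrite XM // YM //.
  have XD f1 f2 : Csmooth f1 -> Csmooth f2 -> X (f1 + f2) = X f1 + X f2.
    by move=> s1 s2; have := XL 1 _ _ s1 s2; rewrite !scale1r.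
  have YD f1 f2 : Csmooth f1 -> Csmooth f2 -> Y (f1 + f2) = Y f1 + Y f2.
    by move=> s1 s2; have := YL 1 _ _ s1 s2; rewrite !scale1r.
  have sXf := XC _ sf; have sXh := XC _ sh.
  have sYf := YC _ sf; have sYh := YC _ sh.
  rewrite XD ?YD; try exact: Csmooth_mul.
  rewrite !XM // !YM //; apply/funext => x.
  have A (f0 h0 Xf Xh Yf Yh XYf YXf XYh YXh : R) :
    (XYf * h0 + Yf * Xh) + (Xf * Yh + f0 * XYh) -
    ((YXf * h0 + Xf * Yh) + (Yf * Xh + f0 * YXh)) =
    (XYf - YXf) * h0 + f0 * (XYh - YXh) by ring.
  exact: A.
- by rewrite XI // YI // XI ?YI //; [exact: XC|exact: YC].
Qed.

Definition lie_bracket (X Y : lieAlg) : lieAlg :=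
  LieAlg (lie_bracket_subproof X Y).

End LieAlgebra.

Section Exponential.
Context {R : realType} {n : nat} {G : lieGroupType R n}.

(* Characterizes exp : Lie(G) -> G uniquely: t |-> exp (tX) is the one-parameter
   subgroup whose velocity at t = 0 is X. *)
Definition is_exponential (exp : lieAlg G -> G) : Prop :=
  forall X : lieAlg G,
    (forall a b : R, exp ((a + b) *: X) = (exp (a *: X) * exp (b *: X))%g) /\
    (forall f : G -> R^o, Csmooth f ->
       is_derive (0 : R) 1 (fun t => f (exp (t *: X))) (X f 1%g)).

End Exponential.

Section LinearAlgebra.
Context {R : realType} {n : nat} {G : lieGroupType R n}.
Implicit Types p S : set (lieAlg G).

Definition is_basis m p (b : 'I_m -> lieAlg G) : Prop :=
  (forall c : 'rV[R]_m, p (\sum_i c 0 i *: b i)) /\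
  (forall x, p x -> exists! c : 'rV[R]_m, x = \sum_i c 0 i *: b i).

Definition is_subspace_of_dim m p : Prop :=
  exists b : 'I_m -> lieAlg G, is_basis p b.

Definition lie_subalgebra S : Prop :=
  [/\ S 0, forall (a : R) x y, S x -> S y -> S (a *: x + y) &
      forall x y, S x -> S y -> S (lie_bracket x y)].

Definition bracket_generating p : Prop :=
  forall S, lie_subalgebra S -> p `<=` S -> S = setT.

End LinearAlgebra.

Section AbsoluteContinuity.
Context {R : realType}.

Definition abs_cont_on (a b : R) (f : R -> R) : Prop :=
  forall eps : R, 0 < eps -> exists2 del : R, 0 < del &
    forall m (x y : 'I_m -> R),
      (forall i, a <= x i /\ x i <= y i /\ y i <= b) ->
      trivIset setT (fun i => [set` `]x i, y i[]) ->
      \sum_i (y i - x i) < del ->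
      \sum_i `|f (y i) - f (x i)| < eps.

Definition loc_abs_cont (D : set R) (f : R -> R) : Prop :=
  forall a b, a <= b -> `[a, b] `<=` D -> abs_cont_on a b f.

End AbsoluteContinuity.

Section SubFinsler.
Context {R : realType} {n : nat} {G : lieGroupType R n}.
Variables (p : set (lieAlg G)) (F : lieAlg G -> R).
Implicit Types (Om : set R) (g : R -> G) (u : R -> lieAlg G).

(* F is only meaningful on p; its values elsewhere are never used. *)
Definition seminorm_on : Prop :=
  [/\ forall v, p v -> 0 <= F v,
      forall v w, p v -> p w -> F (v + w) <= F v + F w &
      forall (l : R) v, 0 <= l -> p v -> F (l *: v) = l * F v].

Definition unit_ball : set (lieAlg G) := [set v | p v /\ F v <= 1].

(* The equation g' = dl_g(u) is tested on C^oo(G): (f o g)' = (u f) o g. *)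
Definition horizontal Om g u : Prop :=
  [/\ forall t, Om t -> p (u t),
      forall a : {linear lieAlg G -> R^o},
        measurable_fun Om (fun t => a (u t) : R),
      forall f : G -> R^o, Csmooth f -> loc_abs_cont Om (f \o g) &
      {ae lebesgue_measure, forall t : R, Om t ->
        forall f : G -> R^o, Csmooth f ->
          is_derive t 1 (f \o g) (u t f (g t))}].

Definition sub_finsler_quasimetric (x y : G) : \bar R :=
  ereal_inf [set l | exists (T : R) g u,
    [/\ 0 <= T, horizontal `[0, T] g u, g 0 = x, g T = y &
        l = (\int[lebesgue_measure]_(t in `[0%R, T]) (F (u t))%:E)%E]].

(* Pontryagin maximum principle; psi is the covector in left trivialization and
   M the constant value of the maximum. *)
Definition PMP Om g (psi : R -> {linear lieAlg G -> R^o}) (M : R) : Prop :=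
  exists u, [/\ horizontal Om g u,
    forall t, Om t -> exists v, psi t v != 0,
    forall v, loc_abs_cont Om (fun t => psi t v) &
    {ae lebesgue_measure, forall t : R, Om t ->
      [/\ forall v, is_derive t 1 (fun r : R => psi r v : R^o)
                      (psi t (lie_bracket (u t) v)),
          F (u t) = 1, psi t (u t) = M &
          forall w, unit_ball w -> psi t w <= M]}].

Definition PMP_curve Om g : Prop := exists psi M, 0 <= M /\ PMP Om g psi M.

(* Only the restriction of g to Om matters. *)
Definition extremal Om g : Prop :=
  [/\ connected Om, PMP_curve Om g &
      forall Om' g', connected Om' -> Om `<=` Om' ->
        (forall t, Om t -> g' t = g t) -> PMP_curve Om' g' -> Om' = Om].

Definition abnormal_extremal Om g : Prop :=
  extremal Om g /\ exists psi, PMP Om g psi 0.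

Definition normal_extremal Om g : Prop :=
  extremal Om g /\ exists psi M, 0 < M /\ PMP Om g psi M.

Definition nonstrictly_abnormal Om g : Prop :=
  abnormal_extremal Om g /\ normal_extremal Om g.

(* F_U in the coordinates u = u_1 e1 + u_2 e2 on p; the supremum is attained
   when F is positive off 0, U being then compact. *)
Definition support_fun (e1 e2 : lieAlg G) (x y : R) : R :=
  sup [set x * u.1 + y * u.2 | u in
        [set u : R * R | unit_ball (u.1 *: e1 + u.2 *: e2)]].

End SubFinsler.

Definition structure_constants (R : realType) (n m : nat) (G : lieGroupType R n)
    (e : 'I_m -> lieAlg G) (C : 'I_m -> 'I_m -> 'I_m -> R) : Prop :=
  forall i j, lie_bracket (e i) (e j) = \sum_k C i j k *: e k.

(* 1-based indices, k = 1, .., 4. *)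
Definition ix (k : nat) : 'I_4 := inord k.-1.

(* Main.v *)
From HB Require Import structures.
Require Import Defs.
From mathcomp Require Import all_boot all_order all_algebra.
From mathcomp Require Import all_classical all_reals all_analysis.
From mathcomp Require Import ring lra.
Set Implicit Arguments. Unset Strict Implicit. Unset Printing Implicit Defensive.
Import Order.TTheory GRing.Theory Num.Theory.
Import numFieldNormedType.Exports.
Local Open Scope classical_set_scope.
Local Open Scope ring_scope.

(* The curve is the one-parameter subgroup of w = c e2 with c = s / F(s e2), so
   its control is w almost everywhere and the adjoint equation reads
   psi'(v) = psi([w, v]).  It has constant coefficients: a covector phi with
   phi([w, .]) = kappa phi gives the solution exp(kappa t) phi.  With phi = e^4
   this is an abnormal lift.  A constant phi = (alpha, 1/c, 0, 0) is a normal
   lift as soon as C_23^1 alpha + C_23^2 / c = 0 and phi supports U at w; if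
   C_23^1 = C_23^2 = 0 such an alpha exists by convexity, otherwise alpha = 0
   works if and only if U lies in the half-plane {y / c <= 1}.

   Conversely let psi be a normal lift, with components psi_i and constant M.
   Then psi_1 is bounded, psi_2 = M / c, and q = psi_3 + C_23^3 psi_1 satisfies
   q' = c (C_23^1 psi_1 + C_23^2 psi_2), while psi_1' = - c psi_3.  If the right
   hand side of q' stayed away from 0, then q, hence psi_3, would grow linearly
   and psi_1 would be unbounded.  For C_23^1 = 0 this forces C_23^2 = 0.  For
   C_23^1 != 0 = C_23^2, a point (x, y) of U with y / c > 1 would give
   psi_1 x <= M - M y / c < 0 for almost all t, so q' would stay away from 0. *)

(** * Absolutely continuous functions *)

(** Real induction. Just before the supremum of the points satisfying [P] there is such a point, and
    the step at the supremum carries [P] past it or up to [b]. Crossing [t] from [r1] to [r2] is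
    what differentiability at the single point [t] can provide. *)
Lemma interval_induction (R : realType) (a b : R) (P : R -> Prop) : a <= b ->
  P a ->
  (forall t, a <= t <= b -> exists2 d : R, 0 < d &
    forall r1 r2, a <= r1 <= t -> t <= r2 <= b -> t - d < r1 -> r2 < t + d ->
      P r1 -> P r2) ->
  P b.
Proof.
move=> ab Pa step.
pose S := [set t | a <= t <= b /\ P t].
have Sa : S a by split; rewrite ?lexx.
have hS : has_sup S by split; [exists a|exists b => t [/andP[]]].
have ac : a <= sup S by apply: ub_le_sup => //; case: hS.
have cb : sup S <= b by apply: ge_sup; [exists a|move=> t [/andP[]]].
have [|d d0 H] := step (sup S); first by rewrite ac cb.
have [r1 [/andP[ar1 r1b] Pr1] r1c] := sup_adherent d0 hS.
have r1S : r1 <= sup S by apply: ub_le_sup; [case: hS|split; rewrite ?ar1].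
have [bc|cb2] := leP b (sup S + d / 2).
  apply: (H r1 b) => //; rewrite ?ar1 ?cb ?lexx //.
  by rewrite (le_lt_trans bc) // ltrD2l ltr_pdivrMr // mulr2n mulrDr mulr1 ltrDl.
have d2 : 0 < d / 2 by rewrite divr_gt0.
have : P (sup S + d / 2).
  apply: (H r1 _) => //; first by rewrite ar1.
    by rewrite lerDl ltW //= ltW.
  by rewrite ltrD2l ltr_pdivrMr // mulr2n mulrDr mulr1 ltrDl.
move=> Pc; have : sup S + d / 2 <= sup S.
  apply: ub_le_sup; [by case: hS|split => //].
  by rewrite (ltW cb2) andbT (le_trans ac) // lerDl ltW.
by rewrite gerDl leNgt d2.
Qed.

Lemma is_derive_ge_near (R : realType) (f : R -> R) (t D eta eps : R) :
  is_derive t 1 (f : R -> R^o) D -> eta <= D -> 0 < eps ->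
  exists2 d : R, 0 < d & forall r1 r2, t - d < r1 <= t -> t <= r2 < t + d ->
    (eta - eps) * (r2 - r1) <= f r2 - f r1.
Proof.
move=> [/derivable_nbhs fd Dv] etaD eps0.
have /eqaddoP /(_ eps eps0) := fd; rewrite Dv => /nbhs_ballP[d /= d0 H].
have K h : `|h| < d -> `|f (t + h) - f t - h * D| <= eps * `|h|.
  move=> hd; have /= := H h; rewrite -ball_normE /= sub0r normrN => /(_ hd).
  rewrite !fctE /= -[h *: 1]/(h * 1) mulr1 -[h *: D]/(h * D).
  by rewrite opprD addrA [t + h]addrC.
exists d => // r1 r2 /andP[dr1 r1t] /andP[tr2 r2d].
have := K (r2 - t); rewrite [t + _]addrC subrK ger0_norm ?subr_ge0 // => /(_ _).
have := K (r1 - t); rewrite [t + _]addrC subrK ler0_norm ?subr_le0 // => /(_ _).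
rewrite !ler_norml => /(_ ltac:(lra)) K1 /(_ ltac:(lra)) K2.
move: K1 K2 => /andP[A1 A2] /andP[A3 A4].
have B1 : 0 <= (D - eta) * (r2 - r1) by apply: mulr_ge0; lra.
nra.
Qed.

Lemma lebesgue_sum_itv_le (R : realType) (U : set R) m (x y : 'I_m -> R) :
  measurable U -> (forall i, x i <= y i) ->
  (forall i, [set` `]x i, y i[] `<=` U) ->
  trivIset setT (fun i => [set` `]x i, y i[]) ->
  ((\sum_i (y i - x i))%:E <= lebesgue_measure U)%E.
Proof.
move=> mU xy sU tI.
have -> : ((\sum_i (y i - x i))%:E = \sum_i lebesgue_measure [set` `]x i, y i[])%E.
  rewrite -sumEFin; apply: eq_bigr => i _.
  rewrite lebesgue_measure_itv /= lte_fin; case: ltP => // yx.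
  suff -> : x i = y i by rewrite subrr.
  by apply/eqP; rewrite eq_le xy yx.
rewrite -measure_bigsetU_ord //; apply: le_measure; rewrite ?inE //.
  exact: bigsetU_measurable.
by elim/big_ind: _ => // A B AU BU; rewrite ?subUset.
Qed.

(** The lower half of the fundamental theorem of calculus, obtained without integrating: real
    induction uses the straddle estimate off an open set of small measure, and absolute continuity
    bounds what is lost inside it. *)
Lemma abs_cont_derive_ge (R : realType) (a b eta : R) (f : R -> R) : a <= b ->
  abs_cont_on a b f ->
  {ae lebesgue_measure, forall t : R, a <= t <= b ->
     exists2 D, eta <= D & is_derive t 1 (f : R -> R^o) D} ->
  eta * (b - a) <= f b - f a.
Proof.
move=> ab fac [N [mN N0 Nf]].
(* The total error is [e * (b - a + 2)]; a positive gap [g] is contradicted by the [e] that makes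
   this error [g / 2]. *)
suff H e : 0 < e -> (eta - e) * (b - a) - 2 * e <= f b - f a.
  rewrite leNgt; apply/negP => lt; set g := eta * (b - a) - (f b - f a).
  have g0 : 0 < g by rewrite /g; lra.
  have k0 : 0 < 2 * (b - a + 2) by lra.
  have := H (g / (2 * (b - a + 2))) (divr_gt0 g0 k0).
  have : g / (2 * (b - a + 2)) * (2 * (b - a + 2)) = g by rewrite divfK // gt_eqF.
  by move: (g / _) => e ee; rewrite /g in ee g0; lra.
move=> e0; have [del1 del10 fdel] := fac e e0.
have k0 : 0 < `|eta| + 1 by rewrite ltr_wpDl.
(* The first bound keeps the variation of [f] over the family below [e], the second keeps [|eta|]
   times its total length below [e]. *)
pose del := Num.min del1 (e / (`|eta| + 1)).
have del0 : 0 < del by rewrite lt_min del10 divr_gt0.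
have [|U [oU NU Ud]] := lebesgue_regularity_outer mN _ del0.
  by rewrite [X in (X < _)%E](_ : _ = 0%E).
have mU : measurable U by exact: (@measurable_realfun.open_measurable R).
have Udel : (lebesgue_measure U < del%:E)%E.
  have -> : U = (U `\` N) `|` N by rewrite setUC setDUK.
  apply: le_lt_trans (measureU2 _ _ _) _ => //; first exact: measurableD.
  by rewrite [X in (_ + X)%E](_ : _ = 0%E) ?adde0 //.
(* [P t]: on [a, t] the growth estimate holds up to the variation of f over a
   finite family of disjoint intervals contained in the open set U covering the
   exceptional null set; absolute continuity makes that loss small at [b]. *)
pose P t := exists (m : nat) (x y : nat -> R), [/\
  forall i, (i < m)%N -> [/\ a <= x i, x i <= y i, y i <= t &
    [set` `]x i, y i[] `<=` U],
  forall i j, (i < j)%N -> (j < m)%N -> y i <= x j &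
  (eta - e) * (t - a) - \sum_(i < m) (`|f (y i) - f (x i)| + `|eta| * (y i - x i)) <= f t - f a].
have : P b.
  apply: (interval_induction ab).
    exists 0%N, (cst 0), (cst 0); split => //.
    by rewrite big_ord0 !subrr mulr0 subr0.
  (* Inside [U] the interval from [r1] to [r2] joins the family and its increment is charged to the
     loss. Outside [U] the derivative exists at [t] and the family is unchanged. *)
  move=> t tab; have [Ut|nUt] := pselect (U t).
    have /nbhs_ballP[d /= d0 dU] : nbhs t U by exact: open_nbhs_nbhs.
    exists d => // r1 r2 /andP[ar1 r1t] /andP[tr2 r2b] dr1 r2d [m [x [y [xy yx fr1]]]].
    exists m.+1, (fun i => if i == m then r1 else x i),
      (fun i => if i == m then r2 else y i); split.
    - move=> i; rewrite ltnS leq_eqVlt; have [-> _|im /= ltim] := eqVneq i m.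
        split => //; first by lra.
        move=> z /=; rewrite in_itv /= => /andP[z1 z2]; apply: dU.
        by rewrite -ball_normE /=; rewrite ltr_norml; lra.
      have [h1 h2 h3 h4] := xy i ltim; split => //; lra.
    - move=> i j; have [-> ij _|jm ij] := eqVneq j m.
        rewrite ltn_eqF //.
        by have [_ _ h _] := xy i ij; exact: le_trans h _.
      rewrite ltnS leq_eqVlt (negbTE jm) /= => ltjm.
      by rewrite ltn_eqF ?(ltn_trans ij ltjm) //; exact: yx.
    - rewrite big_ord_recr /= eqxx.
      under eq_bigr => i _ do rewrite ltn_eqF ?ltn_ord //.
      have := ler_norm (- (f r2 - f r1)); rewrite normrN.
      have r12 := le_trans r1t tr2.
      have : (eta - e) * (r2 - r1) <= `|eta| * (r2 - r1).
        by apply: ler_wpM2r; [lra|have := ler_norm eta; lra].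
      clear -fr1; move: (\sum_(i < m) _) fr1 => S fr1; lra.
  have [D etaD fD] : exists2 D, eta <= D & is_derive t 1 (f : R -> R^o) D.
    by apply: contrapT => H; apply: nUt; apply: NU; apply: Nf => /(_ tab).
  have [d d0 H] := is_derive_ge_near fD etaD e0.
  exists d => // r1 r2 /andP[ar1 r1t] /andP[tr2 r2b] dr1 r2d [m [x [y [xy yx fr1]]]].
  exists m, x, y; split => //.
    by move=> i im; have [h1 h2 h3 h4] := xy i im; split => //; lra.
  have := H r1 r2; rewrite dr1 r1t tr2 r2d => /(_ isT isT).
  lra.
move=> [m [x [y [xy yx fb]]]].
have tI : trivIset setT (fun i : 'I_m => [set` `](x i), (y i)[]).
  move=> i j _ _ [z []] /=; rewrite !in_itv /= => /andP[z1 z2] /andP[z3 z4].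
  apply/val_inj; case: (ltngtP i j) => // ij.
    by have := le_lt_trans (yx _ _ ij (ltn_ord j)) (lt_trans z3 z2); rewrite ltxx.
  by have := le_lt_trans (yx _ _ ij (ltn_ord i)) (lt_trans z1 z4); rewrite ltxx.
have xyU (i : 'I_m) := xy i (ltn_ord i).
have /le_lt_trans /(_ Udel) := lebesgue_sum_itv_le mU
  (fun i => let: And4 _ h _ _ := xyU i in h)
  (fun i => let: And4 _ _ _ h := xyU i in h) tI.
rewrite lte_fin lt_min ltr_pdivlMr // => /andP[lt1 lt2].
have : \sum_(i < m) `|f (y i) - f (x i)| < e.
  by apply: (fdel m (fun i => x i) (fun i => y i)) => // i; have [] := xyU i.
rewrite big_split /= -mulr_sumr in fb.
have : 0 <= \sum_(i < m) (y i - x i).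
  by apply: sumr_ge0 => i _; rewrite subr_ge0; case: (xyU i).
clear -fb lt2; move: (\sum_(i < m) (y i - x i)) (\sum_(i < m) _) fb lt2.
move=> S1 S2; lra.
Qed.

(** By the mean value theorem such a function is Lipschitz on compact intervals. *)
Lemma continuous_derive_loc_abs_cont (R : realType) (D : set R) (f df : R -> R) :
  (forall t : R, is_derive t 1 (f : R -> R^o) (df t)) -> continuous df ->
  loc_abs_cont D f.
Proof.
move=> fdf cdf a b ab _ e e0.
have cn : {within `[a, b], continuous (fun t => `|df t|)}.
  apply: continuous_subspaceT => t; apply: continuous_comp; first exact: cdf.
  exact: norm_continuous.
have [c _ cmax] := EVT_max ab cn.
pose K := `|df c| + 1.
have K0 : 0 < K by rewrite ltr_wpDl.
have lip x y : a <= x -> x <= y -> y <= b -> `|f y - f x| <= K * (y - x).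
  move=> ax xy yb.
  have [|z zxy ->] := @MVT_segment R f df x y xy (fun t _ => fdf t).
    apply: derivable_within_continuous => t _; exact: ex_derive.
  rewrite normrM [`|y - x|]ger0_norm ?subr_ge0 // mulrC [leRHS]mulrC.
  apply: ler_wpM2l; first by rewrite subr_ge0.
  apply: le_trans (cmax z _) _; last by rewrite lerDl.
  move: zxy; rewrite !in_itv /= => /andP[xz zy].
  by rewrite (le_trans ax xz) (le_trans zy yb).
exists (e / K); first by rewrite divr_gt0.
move=> m x y xy _; rewrite ltr_pdivlMr //.
rewrite mulrC; apply: le_lt_trans.
rewrite mulr_sumr; apply: ler_sum => i _.
by have [ax [xy' yb]] := xy i; apply: lip.
Qed.

Lemma lebesgue_ae_mono (R : realType) (P Q : R -> Prop) :
  (forall t, P t -> Q t) -> {ae lebesgue_measure, forall t : R, P t} ->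
  {ae lebesgue_measure, forall t : R, Q t}.
Proof. by move=> PQ; apply: negligibleS => t; apply: contra_not => /PQ. Qed.

Lemma lebesgue_ae_and (R : realType) (P Q : R -> Prop) :
  {ae lebesgue_measure, forall t : R, P t} ->
  {ae lebesgue_measure, forall t : R, Q t} ->
  {ae lebesgue_measure, forall t : R, P t /\ Q t}.
Proof.
move=> aeP aeQ; have := negligibleU aeP aeQ; apply: negligibleS => t /= nPQ.
have [Pt|nPt] := pselect (P t); last by left.
by right => Qt; apply: nPQ.
Qed.

Lemma ae_exists_itv (R : realType) (P : R -> Prop) (a b : R) : a < b ->
  {ae lebesgue_measure, forall t : R, P t} -> exists2 t, a < t < b & P t.
Proof.
move=> ab [N [mN N0 NP]]; apply: contrapT => H.
have : (lebesgue_measure (`]a, b[%classic : set R) <= lebesgue_measure N)%E.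
  apply: le_measure; rewrite ?inE //.
  move=> t /=; rewrite in_itv /= => tab; apply: NP => /= Pt.
  by apply: H; exists t.
rewrite N0 lebesgue_measure_itv /= lte_fin ab -EFinB lee_fin subr_le0.
by rewrite leNgt ab.
Qed.

(** [Q] grows at least linearly, so the derivative of [Y] is eventually at least 1, and [Y] passes
    [B] on a half-line, which is not null. *)
Lemma unbounded_of_growing_derive (R : realType) (Q Y : R -> R) (eta B : R) :
  0 < eta -> loc_abs_cont setT Q -> loc_abs_cont setT Y ->
  {ae lebesgue_measure, forall t : R,
     exists2 D, eta <= D & is_derive t 1 (Q : R -> R^o) D} ->
  {ae lebesgue_measure, forall t : R,
     exists2 D, Q t - B <= D & is_derive t 1 (Y : R -> R^o) D} ->
  ~ {ae lebesgue_measure, forall t : R, Y t <= B}.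
Proof.
move=> eta0 acQ acY dQ dY bY.
have Qge t : 0 <= t -> Q 0 + eta * t <= Q t.
  move=> t0; have := abs_cont_derive_ge t0 (acQ _ _ t0 (@subsetT _ _)).
  move=> /(_ eta); rewrite subr0 => H.
  suff : eta * t <= Q t - Q 0 by lra.
  by apply: H; apply: lebesgue_ae_mono dQ => x + _.
(* From [T] on, [Q] is at least [B + 1]. *)
pose T := Num.max 0 ((B + 1 - Q 0) / eta).
have T0 : 0 <= T by rewrite le_max lexx.
have QT t : T <= t -> B + 1 <= Q t.
  move=> Tt; apply: le_trans (Qge t (le_trans T0 Tt)).
  rewrite -lerBlDl mulrC -ler_pdivrMr //; apply: le_trans Tt.
  by rewrite le_max lexx orbT.
have Yge t : T <= t -> Y T + t - T <= Y t.
  move=> Tt; have := abs_cont_derive_ge Tt (acY _ _ Tt (@subsetT _ _)).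
  move=> /(_ 1); rewrite mul1r => H.
  suff : t - T <= Y t - Y T by lra.
  apply: H; apply: lebesgue_ae_mono dY => x [D QD YD] /andP[Tx _]; exists D => //.
  by apply: le_trans QD; have := QT x Tx; lra.
(* Beyond [T1] the bound [Y T + t - T] exceeds [B]. *)
pose T1 := Num.max T (T + B - Y T).
have [t /andP[tT1 _] Yt] := ae_exists_itv (ltr_pwDr ltr01 (lexx T1)) bY.
have TT1 : T <= T1 by rewrite le_max lexx.
have T1B : T + B - Y T <= T1 by rewrite le_max lexx orbT.
by have := Yge t (ltW (le_lt_trans TT1 tT1)); lra.
Qed.

(** * Left translations are smooth *)

Section CkTheory.
Context {R : realType}.

Lemma Ck_local (V W : normedModType R) k (D : set V) (f : V -> W) :
  (forall x, D x -> exists2 D', D' x & Ck k D' f) -> Ck k D f.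
Proof.
elim: k f => [|k IH] f /= H; first by move=> x /H[D' D'x]; exact.
split=> [x /H[D' D'x [df _]]|v]; first exact: df.
by apply: IH => x /H[D' D'x [_ Cf]]; exists D'.
Qed.

Lemma Ck_coord (V : normedModType R) k n (D : set V) (f : V -> 'rV[R]_n) i :
  open D -> Ck k D f -> Ck k D (fun x => f x 0 i : R).
Proof.
move=> oD; elim: k f => [|k IH] f /=.
  move=> Cf x Dx; apply: (@continuous_comp _ _ _ f (fun M : 'rV[R]_n => M 0 i)).
    exact: Cf.
  exact: coord_continuous.
move=> [df Cf]; split=> [x Dx|v].
  apply: (@differentiable_comp _ _ _ _ f (fun M : 'rV[R]_n => M 0 i : R)).
    exact: df.
  exact: differentiable_coord.
apply: Ck_ext (IH _ (Cf v)) => // x Dx.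
by rewrite derive_mx ?mxE //; apply: diff_derivable; exact: df.
Qed.

Lemma Ck_cst0 (V : normedModType R) k (D : set V) : open D ->
  Ck k D (fun=> 0 : R).
Proof.
move=> oD; elim: k => [|k IH] /=; first by move=> x _; exact: cst_continuous.
split=> [x _|v]; first exact: differentiable_cst.
by apply: Ck_ext IH => // x _; rewrite derive_cst.
Qed.

Lemma Ck_sum (V : normedModType R) k (D : set V) m (f : 'I_m -> V -> R) :
  open D -> (forall i, Ck k D (f i)) -> Ck k D (fun x => \sum_i f i x).
Proof.
move=> oD; elim: m f => [|m IH] f Cf.
  apply: Ck_ext (Ck_cst0 k oD) => // x _; by rewrite big_ord0.
apply: Ck_ext (Ck_lin 1 oD (Cf ord0) (IH _ (fun i => Cf (lift ord0 i)))) => //.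
by move=> x _; rewrite !fctE scale1r big_ord_recl.
Qed.

Lemma Ck_comp (V : normedModType R) k n (D : set V) (E : set 'rV[R]_n)
    (phi : V -> 'rV[R]_n) (f : 'rV[R]_n -> R) :
  open D -> (forall x, D x -> E (phi x)) ->
  Ck k D phi -> Ck k E f -> Ck k D (f \o phi).
Proof.
move=> oD DE; elim: k f => [|k IH] f /=.
  move=> Cp Cf x Dx; apply: continuous_comp; first exact: Cp.
  by apply: Cf; exact: DE.
move=> Cp Cf; have [dp Dp] := Cp; have [df Df] := Cf; split=> [x Dx|v].
  by apply: differentiable_comp; [exact: dp|apply: df; exact: DE].
(* The chain rule in coordinates: the derivative is a sum of products of functions of class [Ck k],
   to which the induction hypothesis applies. *)
apply: (@Ck_ext _ _ _ _ _
  (fun x => \sum_i ('D_v phi x) 0 i * 'D_(delta_mx 0 i) f (phi x))) => //.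
  move=> x Dx; have dpx := dp _ Dx; have dfx := df _ (DE _ Dx).
  apply: esym; rewrite deriveE; last exact: differentiable_comp.
  rewrite diff_comp //= -(deriveE v dpx) {1}(row_sum_delta ('D_v phi x)).
  rewrite linear_sum /=.
  by apply: eq_bigr => i _; rewrite linearZ /= -deriveE.
apply: Ck_sum => // i; apply: Ck_mul => //.
  exact: Ck_coord.
apply: (IH ('D_(delta_mx 0 i) f)) => //; exact: CkS.
Qed.

(** Freezes the left factor in the smooth two-variable multiplication; the derivative of the slice
    along [v] is that of [F] along [(0, v)]. *)
Lemma Ck_slice (U V W : normedModType R) k (D : set (U * V)) (D' : set V)
    (F : U * V -> W) (b : U) :
  open D' -> (forall y, D' y -> D (b, y)) -> Ck k D F ->
  Ck k D' (fun y => F (b, y)).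
Proof.
move=> oD' DD; elim: k F => [|k IH] F /=.
  move=> CF y /DD Dy; apply: (@continuous_comp _ _ _ (fun y : V => (b, y)) F).
    by apply: cvg_pair => //=; exact: cvg_cst.
  exact: CF.
have dp (y : V) : differentiable (fun y : V => (b, y)) y.
  apply: (@differentiable_pair _ _ _ _ (cst b) id).
    exact: differentiable_cst.
  exact: (@ex_diff _ _ _ (nbhs_filter_on y)).
move=> [dF CF]; split=> [y /DD Dy|v].
  by apply: (@differentiable_comp _ _ _ _ (fun y : V => (b, y)) F); [exact: dp|exact: dF].
apply: (@Ck_ext _ _ _ _ _ (fun y => 'D_(0, v) F (b, y))); [exact: oD'| |]; last first.
  exact: (IH ('D_(0, v) F)).
move=> y /DD Dy.
rewrite deriveE; last exact: dF.
rewrite deriveE; last first.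
  by apply: (@differentiable_comp _ _ _ _ (fun y : V => (b, y)) F); [exact: dp|exact: dF].
rewrite (@diff_comp _ _ _ _ (fun y : V => (b, y)) F) //=.
  by rewrite diff_pair //= diff_cst diff_val.
exact: dF.
Qed.

End CkTheory.

Lemma continuous_comp_pair_cst (T U V W : topologicalType) (a : U) (h : T -> V)
    (op : U * V -> W) (z : T) : continuous op ->
  {for z, continuous h} -> {for z, continuous (fun x => op (a, h x))}.
Proof.
move=> cop hz; apply: (@continuous_comp _ _ _ (fun x => (a, h x)) op); last exact: cop.
apply: (@cvg_pair T U V (nbhs z) (nbhs a) (nbhs (h z))) => //.
exact: cvg_cst.
Qed.

Lemma Csmooth_lmul (R : realType) n (G : lieGroupType R n) (a : G)
  (f : G -> R^o) : Csmooth f -> Csmooth (fun x => f (a * x)%g).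
Proof.
move=> sf c Ac k; apply: Ck_local => x [y cy <-{x}].
have [oc oic ck cmc cic] := atlas_chart c Ac.
have [c1 Ac1 c1a] := atlas_cover a.
have [c3 Ac3 c3ay] := atlas_cover (a * y)%g.
have [oc1 oic1 ck1 cmc1 cic1] := atlas_chart c1 Ac1.
have [oc3 oic3 ck3 cmc3 cic3] := atlas_chart c3 Ac3.
(* On this neighbourhood the translate lands in the single chart [c3], so it reads as [f \o cinv c3]
   after multiplication in charts with left factor [cmap c1 a]. *)
pose D := [set z | cimg c z /\ cdom c3 (a * cinv c z)%g].
have oD : open D.
  rewrite openE => z [cz c3z].
  have Lc : {for z, continuous (fun z => (a * cinv c z)%g)}.
    pose H := @Defs.mul_continuous R n G.
    exact: (@continuous_comp_pair_cst _ _ _ _ a _ _ _ H (cic z cz)).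
  have n1 : nbhs z (cimg c) by exact: open_nbhs_nbhs.
  have n3 := Lc _ (open_nbhs_nbhs (conj oc3 c3z)).
  exact: filterI n1 n3.
exists D; first by split; [exists y|rewrite ck].
have S := mul_smooth c1 c c3 Ac1 Ac Ac3 k.
have Sl := @Ck_slice _ _ _ _ _ _ D _ (cmap c1 a) oD _ S.
have {}Sl : Ck k D (fun z => cmap c3 (a * cinv c z)%g).
  apply: (@Ck_ext _ _ _ _ _ (fun z => cmap c3 (cinv c1 (cmap c1 a) * cinv c z)%g)) => //.
    by move=> z _; rewrite ck1.
  by apply: Sl => z [cz c3z]; split => //=; [exists a|rewrite ck1].
apply: (@Ck_ext _ _ _ _ _ ((f \o cinv c3) \o (fun z => cmap c3 (a * cinv c z)%g))) => //.
  by move=> z [cz c3z]; rewrite /= ck3.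
apply: (@Ck_comp _ _ _ _ _ (cimg c3)) => //.
  by move=> z [cz c3z]; exists (a * cinv c z)%g.
exact: sf.
Qed.

(** * Left-invariant fields and one-parameter subgroups *)

Section LieAlgebraFacts.
Context {R : realType} {n : nat} {G : lieGroupType R n}.
Implicit Types X Y Z : lieAlg G.

(** Left invariance spreads the values at [g] over the group: testing on [f] translated by
    [y * g^-1] gives the value at [y]. *)
Lemma lie_field_eq X Y (g : G) :
  (forall f, Csmooth f -> X f g = Y f g) -> X = Y.
Proof.
case: X Y => X PX [Y PY] /= XY; apply: val_inj => /=.
have /asboolP[X0 _ _ _ XI] := PX; have /asboolP[Y0 _ _ _ YI] := PY.
apply/funext => f; have [sf|nsf] := pselect (Csmooth f); last by rewrite X0 ?Y0.
apply/funext => y; have := XY _ (Csmooth_lmul (y * g^-1)%g sf).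
by rewrite XI // YI // mulgVK.
Qed.

Lemma lie_bracketC X Y : lie_bracket X Y = - lie_bracket Y X.
Proof. by apply: val_inj; apply/funext => f; exact/esym/opprB. Qed.

Lemma lie_bracketr_linear X (a : R) Y Z :
  lie_bracket X (a *: Y + Z) = a *: lie_bracket X Y + lie_bracket X Z.
Proof.
apply: (@lie_field_eq _ _ 1%g) => f sf.
have [X0 XC XL XM XI] := asboolP _ (lie_fieldP X).
have [Y0 YC YL YM YI] := asboolP _ (lie_fieldP Y).
have [Z0 ZC ZL ZM ZI] := asboolP _ (lie_fieldP Z).
rewrite /= -[LHS]/((X (a *: Y f + Z f) - (a *: Y (X f) + Z (X f))) 1%g).
rewrite XL //; [|exact: YC|exact: ZC].
have A (p q r t : R) : a * p + q - (a * r + t) = a * (p - r) + (q - t) by ring.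
exact: A.
Qed.

Lemma lie_fieldB X (f h : G -> R^o) :
  Csmooth f -> Csmooth h -> X (f - h) = X f - X h.
Proof.
have [_ _ XL _ _] := asboolP _ (lie_fieldP X) => sf sh.
by have := XL (-1) _ _ sh sf; rewrite !scaleN1r addrC => ->; rewrite addrC.
Qed.

(** Stated as the derivation rule for the adjoint action of [X]. Additivity of fields holds on
    smooth functions only, hence the passage through [lie_field_eq]. *)
Lemma lie_jacobi X Y Z : lie_bracket X (lie_bracket Y Z) =
  lie_bracket (lie_bracket X Y) Z + lie_bracket Y (lie_bracket X Z).
Proof.
apply: (@lie_field_eq _ _ 1%g) => f sf.
have [_ XC _ _ _] := asboolP _ (lie_fieldP X).
have [_ YC _ _ _] := asboolP _ (lie_fieldP Y).
have [_ ZC _ _ _] := asboolP _ (lie_fieldP Z).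
have EX : X (Y (Z f) - Z (Y f)) = X (Y (Z f)) - X (Z (Y f)).
  by apply: lie_fieldB; [exact/YC/ZC|exact/ZC/YC].
have EY : Y (X (Z f) - Z (X f)) = Y (X (Z f)) - Y (Z (X f)).
  by apply: lie_fieldB; [exact/XC/ZC|exact/ZC/XC].
have EZ : Z (X (Y f) - Y (X f)) = Z (X (Y f)) - Z (Y (X f)).
  by apply: lie_fieldB; [exact/XC/YC|exact/YC/XC].
rewrite /= -[LHS]/((X (Y (Z f) - Z (Y f)) - (Y (Z (X f)) - Z (Y (X f)))) 1%g).
rewrite -[RHS]/((X (Y (Z f)) - Y (X (Z f)) - Z (X (Y f) - Y (X f)) +
  (Y (X (Z f) - Z (X f)) - (X (Z (Y f)) - Z (X (Y f))))) 1%g).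
rewrite EX EY EZ; congr (_ 1%g).
have A (p1 p2 p3 p4 p5 p6 : G -> R) :
  p1 - p2 - (p3 - p4) = p1 - p5 - (p6 - p4) + (p5 - p3 - (p2 - p6)) by ring.
exact: A.
Qed.

End LieAlgebraFacts.

Lemma is_derive_translate (R : realType) (F K : R -> R^o) (t D : R) :
  (forall h, F (h + t) = K h) -> is_derive (0 : R) 1 K D -> is_derive t 1 F D.
Proof.
move=> FK [dK vK].
have E : (fun h : R => h^-1 *: ((F \o shift t) (h *: 1) - F t)) =
         (fun h : R => h^-1 *: ((K \o shift 0) (h *: 1) - K 0)).
  by apply/funext => h; rewrite /= addr0 FK -[t in F t]add0r FK.
by split; rewrite /derivable /derive E.
Qed.

Section Curves.
Context {R : realType} {n : nat} {G : lieGroupType R n}.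
Variables (exp : lieAlg G -> G) (exp_def : is_exponential exp).

(** The velocity is given at time 0 only; the group law and left invariance transport it to time
    [t]. *)
Lemma is_derive_exp (X : lieAlg G) (f : G -> R^o) (t : R) : Csmooth f ->
  is_derive t 1 (fun r => f (exp (r *: X))) (X f (exp (t *: X))).
Proof.
move=> sf; have [expD expd] := exp_def X.
have sL := Csmooth_lmul (exp (t *: X)) sf.
have := expd _ sL.
have [_ _ _ _ XI] := asboolP _ (lie_fieldP X).
rewrite XI // mulg1; apply: is_derive_translate => h.
by rewrite addrC expD.
Qed.

Lemma one_parameter_abs_cont (X : lieAlg G) (D : set R) (f : G -> R^o) :
  Csmooth f -> loc_abs_cont D (f \o (fun r => exp (r *: X))).
Proof.
move=> sf; have [_ XC _ _ _] := asboolP _ (lie_fieldP X).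
apply: (@continuous_derive_loc_abs_cont _ _ _ (fun r => X f (exp (r *: X)))).
  by move=> t; exact: is_derive_exp.
move=> t; apply: differentiable_continuous; apply/derivable1_diffP.
by have [] := is_derive_exp X t (XC _ sf).
Qed.

Lemma one_parameter_horizontal (p : set (lieAlg G)) (X : lieAlg G) : p X ->
  horizontal p setT (fun t => exp (t *: X)) (cst X).
Proof.
move=> pX; split=> //.
- by move=> a; apply: (@measurable_cst _ _ _ (measurableTypeR R) _ (a X)).
- by move=> f sf; exact: one_parameter_abs_cont.
- by apply: (aeW lebesgue_measure) => t _ f sf; exact: is_derive_exp.
Qed.

(** At almost every time the control and [X] give the same derivative of every smooth function at
    one point, which determines a left-invariant field. *)
Lemma one_parameter_control (p : set (lieAlg G)) (X : lieAlg G)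
    (u : R -> lieAlg G) : horizontal p setT (fun t => exp (t *: X)) u ->
  {ae lebesgue_measure, forall t : R, u t = X}.
Proof.
move=> [_ _ _]; apply: lebesgue_ae_mono => t /(_ I) H.
apply: (@lie_field_eq _ _ _ _ _ (exp (t *: X))) => f sf.
by have [_ <-] := H _ sf; have [_ <-] := is_derive_exp X t sf.
Qed.

(** The adjoint equation is solved by scaling [phi] by [expR (kappa * t)]; the last hypothesis keeps
    the maximum constant in time. *)
Lemma PMP_eigen_covector (p : set (lieAlg G)) (F : lieAlg G -> R)
    (w : lieAlg G) (phi : {linear lieAlg G -> R^o}) (kappa M : R) :
  p w -> F w = 1 -> (exists v, phi v != 0) ->
  (forall v, phi (lie_bracket w v) = kappa * phi v) ->
  phi w = M -> (forall v, unit_ball p F v -> phi v <= M) ->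
  kappa = 0 \/ M = 0 ->
  PMP p F setT (fun t => exp (t *: w))
    (fun t => expR (kappa * t) \*: phi : {linear _ -> R^o}) M.
Proof.
move=> pw Fw phi0 phiE phiw phiU kM.
have eM t : expR (kappa * t) * M = M.
  by case: kM => ->; rewrite ?mul0r ?expR0 ?mul1r ?mulr0.
have dpsi (t : R) (v : lieAlg G) : is_derive t 1 (fun r : R => expR (kappa * r) * phi v : R^o)
    (expR (kappa * t) * (kappa * phi v)).
  have dk : is_derive t 1 (fun r : R => kappa * r) kappa.
    apply: (@is_derive_eq _ _ _ (kappa \*: (id : R -> R^o))).
    by rewrite -[RHS]mulr1.
  have de := is_derive1_comp (is_derive_expR (kappa * t)) dk.
  rewrite (_ : (fun _ => _) = phi v \*: (expR \o (fun r => kappa * r) : R -> R^o)).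
    apply: is_derive_eq (is_deriveZ (phi v) de) _.
    by rewrite -[LHS]/(phi v * (expR (kappa * t) * kappa)); ring.
  by apply/funext => r; rewrite /= mulrC.
exists (cst w); split => //=.
- exact: one_parameter_horizontal.
- move=> t _; have [v phiv] := phi0; exists v.
  by rewrite mulf_neq0 // gt_eqF // expR_gt0.
- move=> v; apply: (continuous_derive_loc_abs_cont (dpsi^~ v)) => t.
  apply: differentiable_continuous; apply/derivable1_diffP.
  by rewrite -phiE; have [] := dpsi t (lie_bracket w v).
- apply: (aeW lebesgue_measure) => t _; split => //.
  + by move=> v; rewrite phiE; exact: dpsi.
  + by rewrite -[LHS]/(expR (kappa * t) * phi w) phiw eM.
  + move=> v /phiU phiv; rewrite -(eM t) -[leLHS]/(expR (kappa * t) * phi v).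
    by rewrite ler_wpM2l // expR_ge0.
Qed.
End Curves.

(** * Bases and supporting lines *)

(* Hahn-Banach in the plane, at the point (0, 1) of the unit sphere of N. *)
Lemma supporting_slope (R : realType) (N : R -> R -> R) :
  (forall x y, 0 <= N x y) ->
  (forall x y x' y', N (x + x') (y + y') <= N x y + N x' y') ->
  (forall l x y, 0 <= l -> N (l * x) (l * y) = l * N x y) ->
  N 0 1 = 1 ->
  exists alpha : R, forall x y, alpha * x + y <= N x y.
Proof.
move=> N0 NB NZ N1.
have NY y : y <= N 0 y.
  have [y0|/ltW y0] := leP 0 y; last exact: le_trans y0 (N0 _ _).
  by have := NZ y 0 1 y0; rewrite mulr0 mulr1 N1 mulr1 => ->.
(* By homogeneity the slope only has to lie between [z - N (-1) z] and [N 1 z' - z'] for all [z],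
   [z']. Subadditivity puts the first family below the second, so the supremum of the first
   works. *)
pose A := [set z - N (-1) z | z in [set: R]].
have Aub z : ubound A (N 1 z - z).
  move=> _ [y _ <-]; have := NB 1 z (-1) y; rewrite subrr.
  by have := NY (z + y); lra.
have Asup : has_sup A by split; [exists (0 - N (-1) 0), 0|exists (N 1 0 - 0)].
exists (sup A) => x y; case: (ltgtP 0 x) => [x0|x0|<-].
- have : sup A <= N 1 (y / x) - y / x by apply: ge_sup => //; case: Asup.
  have := NZ x 1 (y / x) (ltW x0); rewrite mulr1 mulrC divfK ?gt_eqF // => -> H.
  by rewrite mulrC; have := ler_wpM2l (ltW x0) H; rewrite mulrBr [x * (y / x)]mulrC divfK ?gt_eqF //; lra.
- have nx0 : 0 < - x by rewrite oppr_gt0.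
  have H : y / - x - N (-1) (y / - x) <= sup A.
    by apply: ub_le_sup; [case: Asup|exists (y / - x)].
  have := NZ (- x) (-1) (y / - x) (ltW nx0).
  rewrite mulrN1 opprK [- x * (y / - x)]mulrC divfK ?gt_eqF // => ->.
  have := ler_wpM2l (ltW nx0) H; rewrite mulrBr [- x * (y / - x)]mulrC divfK ?gt_eqF //.
  by lra.
- by rewrite mulr0 add0r.
Qed.

Lemma sum_ix (V : zmodType) (f : 'I_4 -> V) :
  \sum_i f i = f (ix 1) + f (ix 2) + f (ix 3) + f (ix 4).
Proof.
rewrite !big_ord_recl big_ord0 addr0 !addrA.
by congr (f _ + f _ + f _ + f _); apply: val_inj; rewrite /= inordK.
Qed.

Section Bases.
Context {R : realType} {n : nat} {G : lieGroupType R n}.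

Lemma basis_linear_form m (e : 'I_m -> lieAlg G) (a : 'I_m -> R) :
  is_basis setT e ->
  exists phi : {linear lieAlg G -> R^o}, forall i, phi (e i) = a i.
Proof.
move=> [_ eT].
have /boolp.choice[crd crdE] : forall x : lieAlg G,
    exists c : 'rV[R]_m, x = \sum_i c 0 i *: e i.
  by move=> x; have [c [xc _]] := eT x I; exists c.
have uniq (c c' : 'rV[R]_m) : \sum_i c 0 i *: e i = \sum_i c' 0 i *: e i -> c = c'.
  move=> cc'; have [d [_ dU]] := eT (\sum_i c 0 i *: e i) I.
  by rewrite -(dU c erefl) (dU c' cc').
pose f (x : lieAlg G) : R^o := \sum_i crd x 0 i * a i.
have f_lin : linear f.
  move=> k x y; rewrite /f (_ : crd (k *: x + y) = k *: crd x + crd y).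
    rewrite scaler_sumr -big_split /=; apply: eq_bigr => i _.
    by rewrite !mxE mulrDl -[RHS]/(k * (crd x 0 i * a i) + _) mulrA.
  apply: uniq; rewrite -crdE {1}(crdE x) {1}(crdE y) scaler_sumr -big_split /=.
  by apply: eq_bigr => i _; rewrite !mxE scalerDl scalerA.
pose fM := GRing.isLinear.Build _ _ _ _ _ f_lin.
pose phi : {linear lieAlg G -> R^o} := HB.pack f fM.
exists phi => i; rewrite -[LHS]/(f (e i)) /f.
have -> : crd (e i) = delta_mx 0 i.
  apply: uniq; rewrite -crdE (bigD1 i) //= mxE !eqxx scale1r big1 ?addr0 //.
  by move=> j ji; rewrite mxE (negbTE ji) andbF scale0r.
rewrite (bigD1 i) //= mxE !eqxx mul1r big1 ?addr0 // => j ji.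
by rewrite mxE (negbTE ji) andbF mul0r.
Qed.

Lemma basis_linear_form_eq m (e : 'I_m -> lieAlg G)
    (phi psi : {linear lieAlg G -> R^o}) :
  is_basis setT e -> (forall i, phi (e i) = psi (e i)) ->
  forall v, phi v = psi v.
Proof.
move=> [_ eT] E v; have [c [-> _]] := eT v I.
by rewrite !linear_sum; apply: eq_bigr => i _; rewrite !linearZ E.
Qed.

Lemma subspace_closed m (p : set (lieAlg G)) : is_subspace_of_dim m p ->
  forall (a b : R) x y, p x -> p y -> p (a *: x + b *: y).
Proof.
move=> [b0 [bP bU]] a b x y /bU[c [-> _]] /bU[d [-> _]].
have := bP (a *: c + b *: d); congr p.
rewrite !scaler_sumr -big_split /=; apply: eq_bigr => i _.
by rewrite !mxE scalerDl !scalerA.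
Qed.

Lemma plane_span (p : set (lieAlg G)) (x1 x2 : lieAlg G) :
  is_subspace_of_dim 2 p -> p x1 -> p x2 ->
  (forall a b : R, a *: x1 + b *: x2 = 0 -> a = 0 /\ b = 0) ->
  forall x, p x -> exists a b : R, x = a *: x1 + b *: x2.
Proof.
move=> [b0 [bP bU]] /bU[c [-> _]] /bU[d [-> _]] free x /bU[f [-> _]].
(* The rows are the coordinates of [x1] and [x2]; independence makes this square matrix invertible,
   and its inverse yields the new coordinates. *)
pose A : 'M[R]_2 := \matrix_(i, j) if i == 0 then c 0 j else d 0 j.
have combE (a b : R) : a *: \sum_i c 0 i *: b0 i + b *: \sum_i d 0 i *: b0 i =
    \sum_i ((\row_i (if i == 0 then a else b)) *m A) 0 i *: b0 i.
  rewrite !scaler_sumr -big_split /=; apply: eq_bigr => i _.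
  rewrite !mxE !big_ord_recl big_ord0 !mxE /= addr0 scalerDl !scalerA.
  by [].
have rowE (r : 'rV[R]_2) : r = \row_i (if i == 0 then r 0 0 else r 0 1).
  have i01 (i : 'I_2) : i = 0 \/ i = 1.
    by case: i => -[|[|//]] h; [left|right]; apply: val_inj.
  by apply/rowP => i; rewrite mxE; case: (i01 i) => ->.
have Afree : row_free A.
  rewrite -kermx_eq0; apply/rowV0P => r /sub_kermxP rA0.
  have [|a0 a1] := free (r 0 0) (r 0 1).
    by rewrite combE -rowE rA0 big1 // => i _; rewrite mxE scale0r.
  by rewrite (rowE r) a0 a1; apply/rowP => i; rewrite !mxE; case: ifP.
have Aunit : A \in unitmx by rewrite -row_free_unit.
exists ((f *m invmx A) 0 0), ((f *m invmx A) 0 1).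
by rewrite combE -rowE mulmxKV.
Qed.

End Bases.

(** * Lifts of the abnormal curve *)

Lemma forall_ix (P : 'I_4 -> Prop) :
  P (ix 1) -> P (ix 2) -> P (ix 3) -> P (ix 4) -> forall i, P i.
Proof.
move=> P1 P2 P3 P4 [[|[|[|[|//]]]] h].
- by have -> : Ordinal h = ix 1 by apply: val_inj; rewrite /= inordK.
- by have -> : Ordinal h = ix 2 by apply: val_inj; rewrite /= inordK.
- by have -> : Ordinal h = ix 3 by apply: val_inj; rewrite /= inordK.
- by have -> : Ordinal h = ix 4 by apply: val_inj; rewrite /= inordK.
Qed.

Section Bracket.
Context {R : realType} {n : nat} {G : lieGroupType R n}.

HB.instance Definition _ (X : lieAlg G) := GRing.isLinear.Build R
  (lieAlg G) (lieAlg G) *:%R (lie_bracket X) (lie_bracketr_linear X).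

Lemma lie_bracketxx (X : lieAlg G) : lie_bracket X X = 0.
Proof. by apply: val_inj; apply/funext => f; exact: subrr. Qed.

Lemma lie_bracketZl (a : R) (X Y : lieAlg G) :
  lie_bracket (a *: X) Y = a *: lie_bracket X Y.
Proof. by rewrite lie_bracketC linearZ /= -scalerN -lie_bracketC. Qed.

Lemma lie_bracketNl (X Y : lieAlg G) :
  lie_bracket (- X) Y = - lie_bracket X Y.
Proof. by rewrite -scaleN1r lie_bracketZl scaleN1r. Qed.

End Bracket.

Section Lifts.
Context {R : realType} {G : lieGroupType R 4}.
Variables (p : set (lieAlg G)) (F : lieAlg G -> R).
Hypotheses (p_dim2 : is_subspace_of_dim 2 p) (F_seminorm : seminorm_on p F).
Variables (e : 'I_4 -> lieAlg G) (C : 'I_4 -> 'I_4 -> 'I_4 -> R).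
Hypotheses (e_basis : is_basis [set: lieAlg G] e)
  (C_def : structure_constants e C)
  (e1_p : p (e (ix 1))) (e2_p : p (e (ix 2)))
  (e12 : lie_bracket (e (ix 1)) (e (ix 2)) = e (ix 3))
  (e13 : lie_bracket (e (ix 1)) (e (ix 3)) = e (ix 4))
  (C234 : C (ix 2) (ix 3) (ix 4) = 0).
Variables (exp : lieAlg G -> G) (exp_def : is_exponential exp).
Variable (c : R).
Hypotheses (c_neq0 : c != 0) (Fw : F (c *: e (ix 2)) = 1).
Let g t := exp (t *: (c *: e (ix 2))).

Let be1 : lie_bracket (e (ix 2)) (e (ix 1)) = - e (ix 3).
Proof. by rewrite lie_bracketC e12. Qed.

Let be3 : lie_bracket (e (ix 2)) (e (ix 3)) =
  C (ix 2) (ix 3) (ix 1) *: e (ix 1) + C (ix 2) (ix 3) (ix 2) *: e (ix 2) +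
  C (ix 2) (ix 3) (ix 3) *: e (ix 3).
Proof. by rewrite C_def sum_ix C234 scale0r addr0. Qed.

(** Jacobi on [e4 = [e1, e3]]: the term [[[e2, e1], e3] = -[e3, e3]] vanishes, leaving [[e1,
    [e2, e3]]]. *)
Let be4 : lie_bracket (e (ix 2)) (e (ix 4)) =
  C (ix 2) (ix 3) (ix 2) *: e (ix 3) + C (ix 2) (ix 3) (ix 3) *: e (ix 4).
Proof.
rewrite -{1}e13 lie_jacobi be1 lie_bracketNl lie_bracketxx oppr0 add0r be3.
by rewrite !linearD !linearZ /= lie_bracketxx scaler0 add0r e12 e13.
Qed.

Let w_p : p (c *: e (ix 2)).
Proof.
by have := subspace_closed p_dim2 c 0 e2_p e2_p; rewrite scale0r addr0.
Qed.

Let p_span x : p x -> exists a b : R, x = a *: e (ix 1) + b *: e (ix 2).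
Proof.
apply: plane_span => // a b ab0.
have ix12 : ix 2 == ix 1 = false by rewrite -val_eqE /= !inordK.
have [f1 f1e] := basis_linear_form (fun i => (i == ix 1)%:R) e_basis.
have [f2 f2e] := basis_linear_form (fun i => (i == ix 2)%:R) e_basis.
have := congr1 f1 ab0; have := congr1 f2 ab0.
rewrite !linearD !linearZ /= !linear0 !f1e !f2e !eqxx ix12 [ix 1 == _]eq_sym ix12.
rewrite !scaler0 add0r addr0 -[b *: _]/(b * 1) -[a *: _]/(a * 1) !mulr1.
by move=> -> ->.
Qed.

(** The dual form [e^4] vanishes on [p]. By [C234] and [be4], bracketing with [w] has an [e4]
    component only on [e4], so [e^4] is an eigencovector. *)
Lemma abnormal_lift : exists psi, PMP p F setT g psi 0.
Proof.
have [phi phiE] := basis_linear_form (fun i => (i == ix 4)%:R : R) e_basis.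
have ix4 k : (k < 3)%N -> ix k.+1 == ix 4 = false.
  by case: k => [|[|[|//]]] _; rewrite -val_eqE /= !inordK.
have phi1 : phi (e (ix 1)) = 0 by rewrite phiE ix4.
have phi2 : phi (e (ix 2)) = 0 by rewrite phiE ix4.
have phi3 : phi (e (ix 3)) = 0 by rewrite phiE ix4.
have phi4 : phi (e (ix 4)) = 1 by rewrite phiE eqxx.
exists (fun t => expR (c * C (ix 2) (ix 3) (ix 3) * t) \*: phi : {linear _ -> R^o}).
apply: PMP_eigen_covector => //.
- by exists (e (ix 4)); rewrite phi4 oner_neq0.
- apply: (@basis_linear_form_eq _ _ _ _ e (phi \o lie_bracket (c *: e (ix 2)))
    (c * C (ix 2) (ix 3) (ix 3) \*: phi) e_basis).
  apply: forall_ix; rewrite /= lie_bracketZl.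
  + by rewrite be1 linearZ linearN /= phi1 phi3 oppr0 !scaler0.
  + by rewrite lie_bracketxx scaler0 linear0 phi2 scaler0.
  + rewrite be3 linearZ !linearD !linearZ /= phi1 phi2 phi3.
    by rewrite !scaler0 !addr0 scaler0.
  + rewrite be4 linearZ !linearD !linearZ /= phi3 phi4 scaler0 add0r.
    by rewrite scalerA.
- by rewrite linearZ /= phi2 scaler0.
- move=> v [/p_span[a [b ->]] _].
  by rewrite linearD !linearZ /= phi1 phi2 !scaler0 addr0.
- by right.
Qed.

(** A covector constant in time must vanish on [[w, v]] for all [v]. With no [e3] and [e4]
    components this is a condition at [v = e3] only, namely the first hypothesis. *)
Lemma normal_lift (alpha : R) :
  C (ix 2) (ix 3) (ix 1) * alpha + C (ix 2) (ix 3) (ix 2) * c^-1 = 0 ->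
  (forall x y, unit_ball p F (x *: e (ix 1) + y *: e (ix 2)) ->
     alpha * x + c^-1 * y <= 1) ->
  exists psi M, 0 < M /\ PMP p F setT g psi M.
Proof.
move=> Calpha alphaU.
have [phi phiE] := basis_linear_form
  (fun i => if i == ix 1 then alpha else if i == ix 2 then c^-1 else 0) e_basis.
have ixE k l : (k < 4)%N -> (l < 4)%N -> (ix k.+1 == ix l.+1) = (k == l).
  by move=> k4 l4; rewrite -val_eqE /= !inordK.
have phi1 : phi (e (ix 1)) = alpha by rewrite phiE eqxx.
have phi2 : phi (e (ix 2)) = c^-1 by rewrite phiE eqxx ixE.
have phi3 : phi (e (ix 3)) = 0 by rewrite phiE !ixE.
have phi4 : phi (e (ix 4)) = 0 by rewrite phiE !ixE.
have phiw : phi (c *: e (ix 2)) = 1.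
  by rewrite linearZ /= phi2 -[LHS]/(c * c^-1) mulfV.
exists (fun t => expR (0 * t) \*: phi : {linear _ -> R^o}), 1; split => //.
apply: PMP_eigen_covector => //.
- by exists (c *: e (ix 2)); rewrite phiw oner_neq0.
- apply: (@basis_linear_form_eq _ _ _ _ e (phi \o lie_bracket (c *: e (ix 2)))
    (0 \*: phi) e_basis).
  apply: forall_ix; rewrite /= lie_bracketZl scale0r.
  + by rewrite be1 linearZ linearN /= phi3 oppr0 !scaler0.
  + by rewrite lie_bracketxx scaler0 linear0.
  + rewrite be3 linearZ !linearD !linearZ /= phi1 phi2 phi3.
    by rewrite scaler0 addr0 [X in c *: X]Calpha scaler0.
  + by rewrite be4 linearZ !linearD !linearZ /= phi3 phi4 !scaler0 addr0 scaler0.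
- move=> v Uv; have [pv _] := Uv; have [a [b vE]] := p_span pv.
  rewrite vE linearD !linearZ /= phi1 phi2.
  rewrite -[X in X <= _]/(a * alpha + b * c^-1) mulrC [b * _]mulrC.
  by apply: alphaU; rewrite -vE.
- by left.
Qed.

(** * Necessary conditions for a normal lift *)

Lemma lift_along_control psi (M : R) : PMP p F setT g psi M ->
  (forall v, loc_abs_cont setT (fun t => psi t v)) /\
  {ae lebesgue_measure, forall t : R,
    [/\ forall v, is_derive t 1 (fun r : R => psi r v : R^o)
                    (psi t (lie_bracket (c *: e (ix 2)) v)),
        psi t (c *: e (ix 2)) = M &
        forall v, unit_ball p F v -> psi t v <= M]}.
Proof.
move=> [u [hu _ acpsi aepsi]]; split=> //.
have := lebesgue_ae_and (one_parameter_control exp_def hu) aepsi.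
by apply: lebesgue_ae_mono => t [-> /(_ I)[? _ ? ?]].
Qed.

(** [Q] is [k] times the quantity [q], and [Y = -(k/c) psi_1] has derivative [k psi_3]. The factor
    [k] lets each application fix sign and scale. As [F] may be asymmetric, bounding [psi_1] on both
    sides takes [F] at [e1] and at [- e1]. *)
Lemma no_growing_lift psi (M k eta : R) : 0 < F (e (ix 1)) ->
  0 < F (- e (ix 1)) -> 0 < M -> 0 < eta -> PMP p F setT g psi M ->
  ~ {ae lebesgue_measure, forall t : R,
       eta <= k * c * (C (ix 2) (ix 3) (ix 1) * psi t (e (ix 1)) +
                       C (ix 2) (ix 3) (ix 2) * psi t (e (ix 2)))}.
Proof.
move=> F1 F1N M0 eta0 /lift_along_control[acpsi aepsi] growth.
set C233 := C (ix 2) (ix 3) (ix 3).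
have bound t v : p v -> 0 < F v -> (forall v, unit_ball p F v -> psi t v <= M) ->
    psi t v <= M * F v.
  move=> pv Fv H; have [_ _ FZ] := F_seminorm.
  have pv' : p ((F v)^-1 *: v).
    by have := subspace_closed p_dim2 (F v)^-1 0 pv pv; rewrite scale0r addr0.
  have := H ((F v)^-1 *: v).
  rewrite linearZ /= -[_ *: psi t v]/((F v)^-1 * psi t v) mulrC ler_pdivrMr //.
  apply; split=> //.
  by rewrite FZ ?invr_ge0 ?(ltW Fv) // mulVf // gt_eqF.
have e1N_p : p (- e (ix 1)).
  have := subspace_closed p_dim2 (-1) 0 e1_p e1_p.
  by rewrite scale0r addr0 scaleN1r.
pose B1 := M * (F (e (ix 1)) + F (- e (ix 1))).
have bound1 t : (forall v, unit_ball p F v -> psi t v <= M) ->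
    `|psi t (e (ix 1))| <= B1.
  move=> H; have := bound t _ e1_p F1 H; have := bound t _ e1N_p F1N H.
  have := mulr_gt0 M0 F1; have := mulr_gt0 M0 F1N.
  by rewrite linearN /= ler_norml /B1 mulrDr => ? ? ? ?; apply/andP; split; lra.
pose Q t := psi t (k *: (e (ix 3) + C233 *: e (ix 1))).
pose m := - (k / c).
pose Y t := psi t (m *: e (ix 1)).
(* One constant for two bounds: on [Q] minus the derivative of [Y], and on [Y]. *)
pose B := (`|k * C233| + `|k / c|) * B1.
have B10 : 0 <= B1 by rewrite mulr_ge0 ?addr_ge0 ?ltW.
have leB a t : `|psi t (e (ix 1))| <= B1 -> `|a| <= `|k * C233| + `|k / c| ->
    a * psi t (e (ix 1)) <= B.
  move=> H1 H2; apply: le_trans (ler_norm _) _; rewrite normrM.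
  exact: ler_pM.
apply: (@unbounded_of_growing_derive R Q Y eta B) => //.
- exact: acpsi.
- exact: acpsi.
- apply: lebesgue_ae_mono (lebesgue_ae_and aepsi growth) => t [[dpsi _ _]].
  set D := _ * (_ + _) => etaD; exists D => //.
  apply: is_derive_eq (dpsi _) _.
  rewrite lie_bracketZl !linearZ linearD linearZ /= be1 be3 !linearD !linearZ /=.
  rewrite linearN /= /D.
  have A (x1 x2 x3 a b r : R) : k * (a * (c * x1)) + k * (b * (c * x2)) +
    k * (r * (c * x3)) + k * (r * (c * (- x3))) = k * c * (a * x1 + b * x2) by ring.
  exact: A.
- apply: lebesgue_ae_mono aepsi => t [dpsi _ Ut].
  exists (k * psi t (e (ix 3))); last first.
    apply: is_derive_eq (dpsi _) _.
    rewrite lie_bracketZl !linearZ /= be1 linearN.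
    have A (x3 : R) : c * (m * - x3) = k * x3 by rewrite /m; field.
    exact: A.
  have := leB (k * C233) t (bound1 t Ut); rewrite lerDl normr_ge0 => /(_ isT).
  rewrite /Q linearZ linearD linearZ /=.
  have A (x1 x3 : R) : k * C233 * x1 <= B -> k * (x3 + C233 * x1) - B <= k * x3.
    by lra.
  exact: A.
- apply: lebesgue_ae_mono aepsi => t [_ _ Ut].
  have := leB m t (bound1 t Ut); rewrite {1}/m normrN lerDr normr_ge0.
  by move=> /(_ isT); rewrite /Y linearZ.
Qed.

Lemma normal_lift_C232 psi (M : R) : 0 < F (e (ix 1)) ->
  0 < F (- e (ix 1)) -> 0 < M -> PMP p F setT g psi M ->
  C (ix 2) (ix 3) (ix 1) = 0 -> C (ix 2) (ix 3) (ix 2) = 0.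
Proof.
move=> F1 F1N M0 pmp C231; apply/eqP/negPn/negP => C232.
have eta0 : 0 < C (ix 2) (ix 3) (ix 2) ^+ 2 * M.
  by rewrite mulr_gt0 // exprn_even_gt0.
(* With this [k] the growth rate is a square times [c psi_2 = M], hence exactly [eta]. *)
apply: (no_growing_lift (k := C (ix 2) (ix 3) (ix 2)) F1 F1N M0 eta0 pmp).
have [_ aepsi] := lift_along_control pmp.
apply: lebesgue_ae_mono aepsi => t [_ psiw _].
move: psiw; rewrite linearZ /= -[_ *: _]/(c * psi t (e (ix 2))) => <-.
by rewrite C231 mul0r add0r le_eqVlt; apply/orP; left; apply/eqP; ring.
Qed.

Lemma normal_lift_support psi (M x y : R) : 0 < F (e (ix 1)) ->
  0 < F (- e (ix 1)) -> 0 < M -> PMP p F setT g psi M ->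
  C (ix 2) (ix 3) (ix 1) != 0 -> C (ix 2) (ix 3) (ix 2) = 0 ->
  unit_ball p F (x *: e (ix 1) + y *: e (ix 2)) -> c^-1 * y <= 1.
Proof.
move=> F1 F1N M0 pmp C231 C232 Uxy; rewrite leNgt; apply/negP => y1.
have eta0 : 0 < M * (c^-1 * y - 1) by rewrite mulr_gt0 // subr_gt0.
(* This [k] turns the growth rate into [- x psi_1], which the maximum condition at [(x, y)] bounds
   below by [y psi_2 - M]. *)
apply: (no_growing_lift (k := - x / (c * C (ix 2) (ix 3) (ix 1)))
  F1 F1N M0 eta0 pmp).
have [_ aepsi] := lift_along_control pmp.
apply: lebesgue_ae_mono aepsi => t [_ psiw /(_ _ Uxy)].
move: psiw; rewrite linearD !linearZ /= -[_ *: _]/(c * psi t (e (ix 2))).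
rewrite -[_ *: _ + _]/(x * psi t (e (ix 1)) + y * psi t (e (ix 2))).
rewrite C232 mul0r addr0; move: (psi t _) (psi t _) => x1 x2 Mx H.
have -> : - x / (c * C (ix 2) (ix 3) (ix 1)) * c *
  (C (ix 2) (ix 3) (ix 1) * x1) = - (x * x1) by field; rewrite C231 c_neq0.
have -> : M * (c^-1 * y - 1) = y * x2 - M by rewrite -Mx; field.
by lra.
Qed.

End Lifts.

(** * Normality of the abnormal curve in terms of the structure constants and the support
    function *)

Theorem theorem3 (R : realType) (G : lieGroupType R 4)
  (G_connected : connected [set: G])
  (p : set (lieAlg G)) (p_dim2 : is_subspace_of_dim 2 p)
  (p_generating : bracket_generating p)
  (F : lieAlg G -> R) (F_seminorm : seminorm_on p F)
  (F_pos : forall u, p u -> u != 0 -> 0 < F u)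
  (d : G -> G -> \bar R) (d_def : d = sub_finsler_quasimetric p F)
  (exp : lieAlg G -> G) (exp_def : is_exponential exp)
  (e : 'I_4 -> lieAlg G) (e_basis : is_basis [set: lieAlg G] e)
  (C : 'I_4 -> 'I_4 -> 'I_4 -> R) (C_def : structure_constants e C)
  (e1_p : p (e (ix 1))) (e2_p : p (e (ix 2)))
  (e12 : lie_bracket (e (ix 1)) (e (ix 2)) = e (ix 3))
  (e13 : lie_bracket (e (ix 1)) (e (ix 3)) = e (ix 4))
  (C234 : C (ix 2) (ix 3) (ix 4) = 0)
  (C232 : C (ix 2) (ix 3) (ix 1) <> 0 -> C (ix 2) (ix 3) (ix 2) = 0)
  (s : R) (s_pm1 : s = 1 \/ s = -1) :
  nonstrictly_abnormal p F [set: R]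
    (fun t : R => exp ((s * t / F (s *: e (ix 2))) *: e (ix 2)))
  <->
  (C (ix 2) (ix 3) (ix 1) = 0 /\ C (ix 2) (ix 3) (ix 2) = 0) \/
  (C (ix 2) (ix 3) (ix 1) <> 0 /\
   support_fun p F (e (ix 1)) (e (ix 2)) 0 s = 1 / F (s *: e (ix 2))).
Proof.
set e1 := e (ix 1) in e1_p e12 e13 *; set e2 := e (ix 2) in e2_p e12 *.
(* A form equal to 1 on every basis vector shows that [e1] and [e2] are nonzero. *)
have [f1 f1e] := basis_linear_form (fun=> 1) e_basis.
have e1_neq0 : e1 != 0.
  apply/eqP => e10; have := f1e (ix 1).
  by rewrite -/e1 e10 linear0 => /eqP; rewrite eq_sym oner_eq0.
have e2_neq0 : e2 != 0.
  apply/eqP => e20; have := f1e (ix 2).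
  by rewrite -/e2 e20 linear0 => /eqP; rewrite eq_sym oner_eq0.
have pZ (a : R) x : p x -> p (a *: x).
  move=> px; have := subspace_closed p_dim2 a 0 px px.
  by rewrite scale0r addr0.
have ss : s * s = 1 by case: s_pm1 => ->; rewrite ?mulr1 ?mulrNN ?mulr1.
have s_neq0 : s != 0 by apply: contra_eq_neq ss => ->; rewrite mulr0 eq_sym oner_neq0.
have [F0 FD FZ] := F_seminorm.
have F1 : 0 < F e1 by exact: F_pos.
have F1N : 0 < F (- e1) by apply: F_pos; [rewrite -scaleN1r; exact: pZ|rewrite oppr_eq0].
set K := F (s *: e2).
have K0 : 0 < K by apply: F_pos; [exact: pZ|rewrite scaler_eq0 negb_or s_neq0].
have K_neq0 : K != 0 by rewrite gt_eqF.
pose c := s / K.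
have c_neq0 : c != 0 by rewrite mulf_neq0 // invr_eq0.
have sV : s^-1 = s by case: s_pm1 => ->; rewrite ?invrN1 ?invr1.
have cV : c^-1 = K * s by rewrite invf_div sV.
have Fw : F (c *: e2) = 1.
  have Ki : 0 <= K^-1 by rewrite invr_ge0 ltW.
  rewrite -[RHS](mulVf K_neq0) -(FZ _ _ Ki (pZ s _ e2_p)) scalerA.
  by rewrite mulrC.
have -> : (fun t : R => exp ((s * t / K) *: e2)) = (fun t => exp (t *: (c *: e2))).
  by apply/funext => t; rewrite scalerA /c mulrA [t * s]mulrC.
pose A := [set 0 * u.1 + s * u.2 | u in
  [set u : R * R | unit_ball p F (u.1 *: e1 + u.2 *: e2)]].
(* The control [w] lies in the unit ball, so [1 / K] is attained in [A]; the equality for [F_U] says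
   that no point of the ball exceeds it. *)
have Aw : A (1 / K).
  exists (0, c); last by rewrite /= mul0r add0r /c mulrA ss.
  by rewrite /= scale0r add0r; split; [exact: pZ|rewrite Fw].
have abn := abnormal_lift p_dim2 e_basis C_def e1_p e2_p e12 e13 C234 exp_def Fw.
have ext : extremal p F setT (fun t => exp (t *: (c *: e2))).
  split.
  - by apply/connected_intervalP.
  - by have [psi pmp] := abn; exists psi, 0.
  (* The domain is already the whole line, so maximality is immediate. *)
  - by move=> Om' g' _ TOm _ _; apply/seteqP; split => // t _; exact: TOm.
split=> [[_ [_ [psi [M [M0 pmp]]]]]|].
  have [C231|C231] := eqVneq (C (ix 2) (ix 3) (ix 1)) 0.
    left; split=> //.
    exact: (normal_lift_C232 p_dim2 F_seminorm C_def e1_p e12 C234 exp_def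
      c_neq0 F1 F1N M0 pmp).
  right; split; first exact/eqP.
  have Aub : ubound A (1 / K).
    move=> _ [[x y] /= Uxy <-].
    have := normal_lift_support p_dim2 F_seminorm C_def e1_p e12 C234 exp_def
      c_neq0 F1 F1N M0 pmp C231 (C232 (elimN eqP C231)) Uxy.
    by rewrite cV mul0r add0r ler_pdivlMr // [_ * K]mulrC [K * (_ * _)]mulrA.
  apply/eqP; rewrite eq_le; apply/andP; split.
    by apply: ge_sup => //; exists (1 / K).
  by apply: ub_le_sup => //; exists (1 / K).
move=> H; split; split=> //.
suff [alpha Calpha alphaU] : exists2 alpha : R,
    C (ix 2) (ix 3) (ix 1) * alpha + C (ix 2) (ix 3) (ix 2) * c^-1 = 0 &
    forall x y, unit_ball p F (x *: e1 + y *: e2) -> alpha * x + c^-1 * y <= 1.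
  exact: (normal_lift p_dim2 e_basis C_def e1_p e2_p e12 e13 C234 exp_def
    c_neq0 Fw Calpha alphaU).
case: H => [[C1 C2]|[C1 supE]].
  have pN x y : p (x *: e1 + y *: (c *: e2)).
    by apply: subspace_closed p_dim2 _ _ _ _ _ _ => //; exact: pZ.
  (* Coordinates are taken along [e1] and [w], so that [w] becomes the point (0, 1) of the unit
     sphere. *)
  have [||||alpha alphaN] := @supporting_slope R (fun x y => F (x *: e1 + y *: (c *: e2))).
  - by move=> x y; exact: F0.
  - move=> x y x' y'; rewrite 2!scalerDl addrACA; exact: FD.
  - by move=> l x y l0; rewrite -FZ // scalerDr !scalerA.
  - by rewrite scale0r add0r scale1r.
  exists alpha; first by rewrite C1 C2 !mul0r addr0.
  move=> x y [_ Fxy]; apply: le_trans (alphaN _ _) _.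
  by rewrite scalerA mulrC mulrA mulfV // mul1r.
exists 0; first by rewrite C232 // mulr0 mul0r addr0.
move=> x y Uxy; rewrite mul0r add0r cV.
(* [sup] defaults to 0 on a set without supremum, whereas here it equals [1 / K], which is
   nonzero. *)
have Asup : has_sup A.
  apply: contrapT => nA; move: supE; rewrite /support_fun (sup_out nA).
  by move/eqP; rewrite eq_sym mulf_eq0 oner_eq0 invr_eq0 gt_eqF.
have : s * y <= sup A.
  apply: ub_le_sup; first by case: Asup.
  by exists (x, y) => //=; rewrite mul0r add0r.
by rewrite [sup A]supE ler_pdivlMr // [_ * K]mulrC [K * (_ * _)]mulrA.
Qed.
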